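(* Let $\mathbb{F}$ be a field of characteristic not $2$, let $\mathcal{U}$ be a nonzero finite-dimensional $\mathbb{F}$-vector space with $\dim_{\mathbb{F}}\mathcal{U}=n$, and let $b:\mathcal{U}\times\mathcal{U}\to\mathbb{F}$ be a nondegenerate symmetric bilinear form. Let $\mathcal{E}(\mathcal{U},b)=\mathcal{U}\times\mathbb{F}$ be the algebra with multiplication $(u,\alpha)(v,\beta)=(0,b(u,v))$ for $u,v\in\mathcal{U}$, $\alpha,\beta\in\mathbb{F}$. Then $\mathcal{E}(\mathcal{U},b)$ is a nilpotent evolution algebra of type $[1,n]$.
   Context: An evolution algebra (finite-dimensional here) is an algebra $\mathcal{E}$ over $\mathbb{F}$ with a basis $\{e_1,\ldots,e_m\}$ (a natural basis) such that $e_je_k=0$ for $j\neq k$. For an algebra $\mathcal{A}$, $\mathrm{ann}(\mathcal{A})=\{x\in\mathcal{A}: x\mathcal{A}=\mathcal{A}x=0\}$, $\mathrm{ann}^0(\mathcal{A})=0$, and $\mathrm{ann}^i(\mathcal{A})$ is defined by $\mathrm{ann}^i(\mathcal{A})/\mathrm{ann}^{i-1}(\mathcal{A})=\mathrm{ann}(\mathcal{A}/\mathrm{ann}^{i-1}(\mathcal{A}))$. With $\mathcal{A}^1=\mathcal{A}$ and $\mathcal{A}^{k+1}=\sum_{j=1}^k\mathcal{A}^j\mathcal{A}^{k+1-j}$, $\mathcal{A}$ is nilpotent if $\mathcal{A}^m=0$ for some $m$, equivalently $\mathrm{ann}^r(\mathcal{A})=\mathcal{A}$ for some $r$. The type of a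 finite-dimensional nilpotent algebra $\mathcal{A}$ is the sequence $[n_1,\ldots,n_r]$, where $r$ is the least natural number with $\mathrm{ann}^r(\mathcal{A})=\mathcal{A}$ and $n_i=\dim\mathrm{ann}^i(\mathcal{A})-\dim\mathrm{ann}^{i-1}(\mathcal{A})$. *)

(* Defs.v *)
From HB Require Import structures.
From mathcomp Require Import all_boot all_order all_algebra.
Set Implicit Arguments.
Unset Strict Implicit.
Unset Printing Implicit Defensive.
Import GRing.Theory.
Local Open Scope ring_scope.

(* A finite-dimensional algebra (not necessarily associative, commutative or
   unital) over F is a pair of a vectType A and a bilinear product m on A. *)

(* A / I is carried by the complement I^C of I; the canonical map A -> A / I is
   the projection onto I^C along I (vsproj alone would project along (I^C)^C).
   See ker_quo_proj and quo_proj_surj. *)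
Notation quo_space I := (subvs_of (I^C)%VS).

Section QuotientSpace.
Variables (F : fieldType) (A : vectType F) (I : {vspace A}).

Definition quo_proj_fun (x : A) : quo_space I :=
  vsproj (I^C)%VS (daddv_pi (I^C)%VS I x).

Fact quo_proj_is_linear : linear quo_proj_fun.
Proof. by move=> a x y; rewrite /quo_proj_fun !linearP. Qed.

HB.instance Definition _ := GRing.isSemilinear.Build F A (quo_space I) _
  quo_proj_fun (GRing.semilinear_linear quo_proj_is_linear).

Definition quo_proj : 'Hom(A, quo_space I) := linfun quo_proj_fun.

Lemma val_quo_proj x : vsval (quo_proj x) = daddv_pi (I^C)%VS I x.
Proof. by rewrite lfunE /= vsprojK // memv_pi. Qed.

Lemma quo_proj_val u : quo_proj (vsval u) = u.
Proof.
apply: val_inj; rewrite /= val_quo_proj daddv_pi_id ?subvsP //.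
by apply/eqP; rewrite capvC capv_compl.
Qed.

Lemma quo_proj_surj : limg quo_proj = fullv.
Proof.
apply/vspaceP=> u; rewrite memvf; apply/memv_imgP.
by exists (vsval u); rewrite ?memvf ?quo_proj_val.
Qed.

Lemma quo_proj_eq0 x : (quo_proj x == 0) = (x \in I).
Proof.
have dxI : (I^C :&: I = 0)%VS by rewrite capvC capv_compl.
have dx : x = daddv_pi I (I^C)%VS x + daddv_pi (I^C)%VS I x.
  by rewrite daddv_pi_add ?addv_complf ?memvf // capv_compl.
apply/idP/idP => [/eqP px0 | xI].
  by rewrite dx -val_quo_proj px0 /= addr0 memv_pi.
rewrite -[quo_proj x]vsvalK val_quo_proj.
have -> : daddv_pi (I^C)%VS I x = 0; last by rewrite linear0.
have /eqP := dx; rewrite daddv_pi_id ?capv_compl //.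
by rewrite -subr_eq0 opprD addrA subrr sub0r oppr_eq0 => /eqP.
Qed.

Lemma ker_quo_proj : lker quo_proj = I.
Proof. by apply/vspaceP=> x; rewrite memv_ker quo_proj_eq0. Qed.

Lemma sub_quo_proj x : x - vsval (quo_proj x) \in I.
Proof. by rewrite -quo_proj_eq0 linearB /= quo_proj_val subrr. Qed.

End QuotientSpace.

Section Algebra.
Variables (F : fieldType) (A : vectType F) (m : {bilinear A -> A -> A}).

Definition natural_basis (e : (\dim {:A}).-tuple A) : Prop :=
  basis_of {:A}%VS e /\
  forall j k : 'I_(\dim {:A}), j != k -> m (tnth e j) (tnth e k) = 0.

Definition evolution_algebra : Prop := exists e, natural_basis e.

Definition prod_space (V W : {vspace A}) : {vspace A} :=
  <<[seq m x y | x <- vbasis V, y <- vbasis W]>>%VS.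

Lemma mem_prod_space (V W : {vspace A}) x y :
  x \in V -> y \in W -> m x y \in prod_space V W.
Proof.
move=> /coord_vbasis-> /coord_vbasis->.
rewrite linear_sumlz memv_suml // => i _.
rewrite linear_sumr memv_suml // => j _.
rewrite linearZl_LR /= linearZr_LR /= !memvZ //.
by apply/memv_span/allpairs_f; rewrite memt_nth.
Qed.

Lemma prod_space_sub (V W X : {vspace A}) :
  (forall x y, x \in V -> y \in W -> m x y \in X) -> (prod_space V W <= X)%VS.
Proof.
move=> mX; apply/span_subvP=> _ /allpairsP[[x y] /= [xV yW ->]].
by apply: mX; apply: vbasis_mem.
Qed.

(* powers k lists A^1, ..., A^(k+1); see size_powers, alg_pow1 and alg_powS. *)
Fixpoint powers (k : nat) : seq {vspace A} :=
  if k is k'.+1 then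
    let s := powers k' in
    rcons s (\sum_(j < size s)
               prod_space (nth 0 s j) (nth 0 s (size s - j.+1)))%VS
  else [:: fullv].

(* The power A^k for k >= 1; alg_pow 0 is a junk value equal to A. *)
Definition alg_pow (k : nat) : {vspace A} := nth 0%VS (powers k.-1) k.-1.

Lemma size_powers k : size (powers k) = k.+1.
Proof. by elim: k => //= k IHk; rewrite size_rcons IHk. Qed.

Lemma alg_pow1 : alg_pow 1 = fullv. Proof. by []. Qed.

Lemma nth_powers k j : (j <= k)%N -> nth 0%VS (powers k) j = alg_pow j.+1.
Proof.
elim: k => [|k IHk]; first by rewrite leqn0 => /eqP->.
rewrite leq_eqVlt => /predU1P[-> // | ltjk].
by rewrite /= nth_rcons size_powers ltjk IHk.
Qed.

Lemma alg_powS k : (0 < k)%N ->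
  alg_pow k.+1 =
  (\sum_(1 <= j < k.+1) prod_space (alg_pow j) (alg_pow (k.+1 - j)))%VS.
Proof.
case: k => // k _.
rewrite [LHS]/alg_pow [powers _]/= nth_rcons size_powers ltnn eqxx.
rewrite big_add1 big_mkord; apply: eq_bigr => j _.
rewrite !nth_powers ?leq_subr -1?ltnS ?ltn_ord //.
  by rewrite subSS [in RHS]subSn // -ltnS.
by rewrite subSS ltnS leq_subr.
Qed.

Definition nilpotent_algebra : Prop :=
  exists2 k, (0 < k)%N & alg_pow k = 0%VS.

Definition mul_l (x : A) : 'Hom(A, A) := linfun (m x).
Definition mul_r (x : A) : 'Hom(A, A) := linfun (applyr m x).

Definition ann : {vspace A} :=
  (\bigcap_(i < \dim {:A})
     (lker (mul_l (vbasis {:A})`_i) :&: lker (mul_r (vbasis {:A})`_i)))%VS.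

Lemma annP x : reflect (forall y, m x y = 0 /\ m y x = 0) (x \in ann).
Proof.
apply: (iffP idP) => [/subv_bigcapP xann y | xann].
  have xe i : m x (vbasis {:A})`_i = 0 /\ m (vbasis {:A})`_i x = 0.
    have [ltin | lein] := ltnP i (\dim {:A}); last first.
      by rewrite nth_default ?size_tuple // linear0r linear0l.
    have := xann (Ordinal ltin) isT.
    by rewrite -memvE memv_cap !memv_ker !lfunE /= => /andP[/eqP ? /eqP ?].
  rewrite (coord_vbasis (memvf y)) linear_sumr linear_sumlz.
  split; apply: big1 => i _.
    by rewrite linearZr_LR /= (xe i).1 scaler0.
  by rewrite linearZl_LR /= (xe i).2 scaler0.
apply/subv_bigcapP=> i _; rewrite -memvE memv_cap !memv_ker !lfunE /=.
by rewrite !(xann _).1 !(xann _).2 eqxx.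
Qed.

End Algebra.

Section QuotientAlgebra.
Variables (F : fieldType) (A : vectType F) (m : {bilinear A -> A -> A}).
Variable I : {vspace A}.

(* The product (x + I)(y + I) = xy + I, computed on the representatives in I^C;
   for an ideal I it does not depend on representatives, see quo_mulE. *)
Definition quo_mul (u v : quo_space I) : quo_space I :=
  quo_proj I (m (vsval u) (vsval v)).

Fact quo_mul_is_bilinear : bilinear_for
  (GRing.Scale.Law.clone _ _ *:%R _) (GRing.Scale.Law.clone _ _ *:%R _) quo_mul.
Proof.
split=> u a v w; rewrite /quo_mul /=.
  by rewrite linearPl /= linearP.
by rewrite linearPr /= linearP.
Qed.

HB.instance Definition _ :=
  bilinear_isBilinear.Build F _ _ _ _ _ quo_mul quo_mul_is_bilinear.

Definition ideal : Prop :=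
  forall x y, x \in I -> m x y \in I /\ m y x \in I.

Lemma quo_mulE x y : ideal ->
  quo_mul (quo_proj I x) (quo_proj I y) = quo_proj I (m x y).
Proof.
move=> idI; apply/eqP; rewrite eq_sym -subr_eq0 -linearB quo_proj_eq0.
set x' := vsval _; set y' := vsval _.
have -> : m x y - m x' y' = m (x - x') y + m x' (y - y').
  by rewrite linearBl linearBr /= addrA subrK.
by rewrite memvD // ?(idI _ _ (sub_quo_proj _ _)).1
  ?(idI _ _ (sub_quo_proj _ _)).2.
Qed.

End QuotientAlgebra.

Section AnnihilatorSeries.
Variables (F : fieldType) (A : vectType F) (m : {bilinear A -> A -> A}).

(* ann^(i+1) is the preimage in A of ann (A / ann^i). *)
Fixpoint ann_series (i : nat) : {vspace A} :=
  if i is j.+1 then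
    (quo_proj (ann_series j) @^-1: ann (quo_mul m (I := ann_series j)))%VS
  else 0%VS.

Lemma ann_series_ideal i : ideal m (ann_series i).
Proof.
elim: i => [|i IHi] x y.
  by rewrite /= memv0 => /eqP->; rewrite linear0l linear0r memv0 eqxx.
rewrite /= -!memv_preim => /annP xann.
have mI : m x y \in ann_series i /\ m y x \in ann_series i.
  rewrite -!quo_proj_eq0 -!quo_mulE //.
  by rewrite (xann _).1 (xann _).2 eqxx.
have proj0 z : z \in ann_series i -> quo_proj (ann_series i) z = 0.
  by rewrite -quo_proj_eq0 => /eqP.
by rewrite (proj0 _ mI.1) (proj0 _ mI.2) mem0v.
Qed.

Lemma mem_ann_seriesS i x :
  (x \in ann_series i.+1) <->
  (forall y, m x y \in ann_series i /\ m y x \in ann_series i).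
Proof.
rewrite /= -memv_preim; split=> [/annP xann y | xI].
  rewrite -!quo_proj_eq0 -!quo_mulE; try exact: ann_series_ideal.
  by rewrite (xann _).1 (xann _).2 eqxx.
apply/annP=> u.
rewrite /= -[u]quo_proj_val !quo_mulE; try exact: ann_series_ideal.
by split; apply/eqP; rewrite quo_proj_eq0; have [] := xI (vsval u).
Qed.

Lemma ann_series_sub i : (ann_series i <= ann_series i.+1)%VS.
Proof.
by apply/subvP=> x xI; apply/mem_ann_seriesS=> y; apply: ann_series_ideal.
Qed.

(* The truncated subtraction is harmless, by ann_series_sub. *)
Definition algebra_type (s : seq nat) : Prop :=
  [/\ ann_series (size s) = fullv,
      forall i, (i < size s)%N -> ann_series i <> fullv
    & forall i, (i < size s)%N ->
        nth 0%N s i = (\dim (ann_series i.+1) - \dim (ann_series i))%N].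

End AnnihilatorSeries.

Section FormAlgebra.
Variables (F : fieldType) (U : vectType F) (b : {symmetric U}).

(* F^o is F as a vector space over itself. *)
Definition form_mul (x y : U * F^o) : U * F^o := (0, b x.1 y.1).

Fact form_mul_is_bilinear : bilinear_for
  (GRing.Scale.Law.clone _ _ *:%R _) (GRing.Scale.Law.clone _ _ *:%R _) form_mul.
Proof.
split=> z a x y; rewrite /form_mul; apply/eqP; rewrite xpair_eqE /=.
  by rewrite scaler0 addr0 eqxx linearPl /=.
by rewrite scaler0 addr0 eqxx linearPr /=.
Qed.

HB.instance Definition _ :=
  bilinear_isBilinear.Build F _ _ _ _ _ form_mul form_mul_is_bilinear.

End FormAlgebra.

(* Main.v *)
Require Import Defs.
From HB Require Import structures.
From mathcomp Require Import all_boot all_order all_algebra.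
Import GRing.Theory.
Local Open Scope ring_scope.

(* In characteristic not 2 a symmetric form has an orthogonal basis; together
   with (0, 1) it is a natural basis of U * F.  By nondegeneracy the annihilator
   is the line 0 * F, and it contains every product, so that ann^2 is everything
   and every product of three elements vanishes. *)

Lemma size_basis_seq {F : fieldType} {U : vectType F} {V : {vspace U}}
  {X : seq U} : basis_of V X -> size X = \dim V.
Proof.
by move=> XV; rewrite -(span_basis XV); apply/esym/eqP; apply: basis_free XV.
Qed.

Section SymmetricForm.
Context {F : fieldType} {U : vectType F} (b : {symmetric U}).

Lemma symC u v : b u v = b v u.
Proof. by rewrite hermC expr0 mul1r. Qed.

Lemma form_polarization u v :
  b (u + v) (u + v) = b u u + b v v + b u v *+ 2.
Proof. by rewrite hnormD expr0 mul1r mulr2n. Qed.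

(** If [u] and [v] are both isotropic, polarization leaves [b (u + v) (u + v) = 2 b u v], which is
    nonzero because 2 is invertible in [F]. *)
Lemma exists_anisotropic (V : {vspace U}) u v : 2%N \notin [pchar F] ->
  u \in V -> v \in V -> b u v != 0 -> exists2 w, w \in V & b w w != 0.
Proof.
move=> F2 uV vV buv.
have [bu | bu] := eqVneq (b u u) 0; last by exists u.
have [bv | bv] := eqVneq (b v v) 0; last by exists v.
exists (u + v); first exact: memvD.
by rewrite form_polarization bu bv !add0r -mulr_natl mulf_neq0 //.
Qed.

(** Induction on the dimension, over all subspaces: split off an anisotropic vector [w] of [V] and
    recurse on the part of [V] orthogonal to [w], of dimension one less. *)
Lemma exists_orthogonal_basis (V : {vspace U}) : 2%N \notin [pchar F] ->
  exists2 X : seq U, basis_of V X & pairwise [rel u v | b u v == 0] X.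
Proof.
move=> F2; move dimV: (\dim V) => d; elim: d V dimV => [|d IHd] V dimV.
  exists [::] => //; rewrite basisEdim span_nil dimV leqnn andbT.
  by rewrite subv0 -dimv_eq0 dimV.
(* Either [b] vanishes identically on [V], and any basis will do, or some pair in [V] has a nonzero
   product. *)
have [| /subvPn[u uV /mem_orthovPn[v vV buv]]] := boolP (V <= orthov b V)%VS.
  move/orthovP=> bV0; exists (vbasis V); first exact: vbasisP.
  apply/(pairwiseP 0) => i j ilt jlt _; apply/eqP.
  by apply: bV0; apply: vbasis_mem; apply: mem_nth.
have [w wV bw] := exists_anisotropic V u v F2 uV vV buv.
have wnV : w \notin orthov b V by apply/mem_orthovPn; exists w.
have dimW := eq_dim_orthov1 wnV; rewrite dimV /= in dimW.
have [X XV oX] := IHd _ (esym dimW).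
have memX x : x \in X -> x \in V /\ b w x = 0.
  move/(basis_mem XV); rewrite memv_cap mem_orthov1 => /andP[xV /eqP bxw].
  by rewrite symC.
exists (w :: X); last first.
  by rewrite /= oX andbT; apply/allP=> x /memX[_ bwx]; apply/eqP.
(* The span of [X] is orthogonal to [w], whereas [b w w] is nonzero. *)
have wX : w \notin <<X>>%VS.
  by rewrite (span_basis XV) memv_cap mem_orthov1 (negPf bw) andbF.
rewrite basisEfree free_cons wX (basis_free XV) /= dimV.
rewrite ltnS (size_basis_seq XV) -dimW leqnn andbT.
by apply/span_subvP=> x; rewrite inE => /predU1P[-> // | /memX[]].
Qed.

End SymmetricForm.

Section FormAlgebraTheory.
Context {F : fieldType} {U : vectType F} (b : {symmetric U}).
Local Notation A := (U * F^o)%type.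

Let e0 : A := (0, 1).

Lemma form_algebra_dim : \dim {:A} = (\dim {:U}).+1.
Proof. by rewrite !dimvf [LHS]addn1. Qed.

Lemma mem_center_line (x : A) : (x \in <[e0]>%VS) = (x.1 == 0).
Proof.
apply/vlineP/eqP => [[k ->] | x0]; first by rewrite /= scaler0.
exists x.2; case: x x0 => u a /= ->.
by congr pair; rewrite ?scaler0 //= [RHS]mulr1.
Qed.

Lemma form_mul_line (x y : A) : form_mul b x y \in <[e0]>%VS.
Proof. by rewrite mem_center_line. Qed.

Lemma line_form_mul (x y : A) : x \in <[e0]>%VS ->
  form_mul b x y = 0 /\ form_mul b y x = 0.
Proof.
by rewrite mem_center_line /form_mul => /eqP->; rewrite linear0l linear0r.
Qed.

Lemma form_algebra_nilpotent : nilpotent_algebra (form_mul b).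
Proof.
(* The cube expands to [A A^2 + A^2 A]; [A^2] lies in the line of [e0], which annihilates [A] on
   both sides. *)
exists 3%N => //; apply/eqP; rewrite -subv0 alg_powS // big_ltn // big_ltn // big_geq //.
have pow2 : (alg_pow (form_mul b) 2 <= <[e0]>)%VS.
  rewrite alg_powS // big_nat1; apply: prod_space_sub => x y _ _.
  exact: form_mul_line.
rewrite addv0 subv_add; apply/andP; split; apply: prod_space_sub => x y xP yP.
  by rewrite /= (line_form_mul y x (subvP pow2 y yP)).2 mem0v.
by rewrite /= (line_form_mul x y (subvP pow2 x xP)).1 mem0v.
Qed.

Lemma form_algebra_evolution : 2%N \notin [pchar F] ->
  evolution_algebra (form_mul b).
Proof.
move=> F2; have [X XU oX] := exists_orthogonal_basis b fullv F2.
pose inj_fun (u : U) : A := (u, 0).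
have inj_lin : linear inj_fun.
  by move=> a u v; rewrite /inj_fun; congr pair => /=; rewrite scaler0 addr0.
pose injM := GRing.isSemilinear.Build _ _ _ _ inj_fun
  (GRing.semilinear_linear inj_lin).
pose injL : {linear U -> A} := HB.pack inj_fun injM.
pose e : seq A := e0 :: map inj_fun X.
have size_e : size e = \dim {:A}.
  by rewrite /= size_map (size_basis_seq XU) form_algebra_dim.
(* As [e] has [\dim {:A}] elements, spanning is enough. *)
have basis_e : basis_of {:A}%VS e.
  rewrite basisEdim size_e leqnn andbT; apply/subvP=> -[u a] _.
  have -> : (u, a) = a *: e0 + inj_fun u.
    by congr pair => /=; rewrite ?scaler0 ?add0r // addr0 [RHS]mulr1.
  rewrite span_cons memv_add ?memvZ ?memv_line //.
  (* Passing to a bundled linear map lets [limg_span] identify the span of the image of [X] with the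
     image of its span. *)
  have -> : inj_fun u = linfun injL u by rewrite lfunE.
  have -> : map inj_fun X = map (linfun injL) X.
    by apply: eq_map => x; rewrite lfunE.
  by rewrite -limg_span memv_img // (span_basis XU) memvf.
have orth_e : pairwise [rel x y | form_mul b x y == 0] e.
  rewrite /= pairwise_map; apply/andP; split.
    by apply/allP=> x _; rewrite /= (line_form_mul _ _ (memv_line e0)).1.
  apply: sub_pairwise oX => x y /= /eqP bxy.
  by rewrite /form_mul /= bxy.
have mulC (x y : A) : form_mul b x y = form_mul b y x.
  by rewrite /form_mul symC.
have size_eP : size e == \dim {:A} by rewrite size_e.
exists (Tuple size_eP); split=> // j k.
(* [pairwise] only compares an entry with later ones; commutativity of the product covers the other
   order. *)
wlog ltjk : j k / (j < k)%N => [IH | _].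
  case: (ltngtP j k) => [jk | kj | /val_inj->]; last by rewrite eqxx.
    exact: IH.
  by rewrite eq_sym /= mulC; apply: IH.
rewrite !(tnth_nth 0); apply/eqP.
by move/(pairwiseP 0): orth_e; apply=> //; rewrite inE size_e.
Qed.

Lemma form_algebra_ann1 : nondegenerate b ->
  ann_series (form_mul b) 1 = <[e0]>%VS.
Proof.
move=> /eqP b_nd; apply/vspaceP=> x; apply/idP/idP; last first.
  move=> x0; apply/mem_ann_seriesS => y.
  by rewrite /= (line_form_mul x y x0).1 (line_form_mul x y x0).2 mem0v.
move/mem_ann_seriesS=> xann; rewrite mem_center_line -memv0 -b_nd.
(* Multiplying [x] by [(v, 0)] gives [(0, b x.1 v)], so [x.1] lies in the radical of [b], which is
   zero. *)
apply/mem_orthovP => v _; have [+ _] := xann (v, 0).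
by rewrite memv0 => /eqP[].
Qed.

Lemma form_algebra_ann2 : nondegenerate b ->
  ann_series (form_mul b) 2 = fullv.
Proof.
move=> b_nd; apply/vspaceP=> x; rewrite memvf; apply/mem_ann_seriesS => y.
by rewrite form_algebra_ann1 // !form_mul_line.
Qed.

Lemma form_algebra_type : {:U}%VS <> 0%VS -> nondegenerate b ->
  algebra_type (form_mul b) [:: 1%N; \dim {:U}].
Proof.
move=> U0 b_nd; have e0_neq0 : e0 != 0.
  by apply/eqP=> -[] /eqP; rewrite oner_eq0.
have dim1 : \dim (ann_series (form_mul b) 1) = 1%N.
  by rewrite form_algebra_ann1 // dim_vline e0_neq0.
have dim2 : \dim (ann_series (form_mul b) 2) = (\dim {:U}).+1.
  by rewrite form_algebra_ann2 // form_algebra_dim.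
have dim0 : \dim (ann_series (form_mul b) 0) = 0%N by rewrite dimv0.
split; first exact: form_algebra_ann2.
  case=> [|[|//]] _ /(congr1 (fun V => \dim V)); rewrite form_algebra_dim.
    by rewrite dim0.
  (* If [ann^1] were the whole algebra, then [1 = \dim {:U} + 1], forcing [U] to be zero. *)
  by rewrite dim1 => -[/esym/eqP]; rewrite dimv_eq0 => /eqP.
case=> [|[|//]] _; first by rewrite dim1 dim0.
by rewrite dim2 dim1 subn1.
Qed.

End FormAlgebraTheory.

Theorem proposition4p2 (F : fieldType) (hF : 2%N \notin [pchar F])
    (U : vectType F) (n : nat) (hU : {:U}%VS <> 0%VS) (hn : \dim {:U} = n)
    (b : {symmetric U}) (hb : nondegenerate b) :
  [/\ nilpotent_algebra (form_mul b),
      evolution_algebra (form_mul b)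
    & algebra_type (form_mul b) [:: 1%N; n]].
Proof.
split; first exact: form_algebra_nilpotent.
  exact: form_algebra_evolution.
by rewrite -hn; apply: form_algebra_type.
Qed.
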